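(* Let $\mathbb{H}$ be a complex Hilbert space and let $x,y,z\in\mathbb{H}$. Then $$|\langle x,y\rangle|^2+|\langle x,z\rangle|^2\le \|x\|\sqrt{|\langle x,y\rangle|^2\|y\|^2+|\langle x,z\rangle|^2\|z\|^2+2|\langle x,y\rangle|\,|\langle x,z\rangle|\,|\langle y,z\rangle|}.$$ In particular, for all $x,y\in\mathbb{H}$ and every $e\in\mathbb{H}$ with $\|e\|=1$, $$|\langle x,e\rangle|^2+|\langle y,e\rangle|^2\le \sqrt{|\langle x,e\rangle|^2\|x\|^2+|\langle y,e\rangle|^2\|y\|^2+2|\langle x,e\rangle|\,|\langle y,e\rangle|\,|\langle x,y\rangle|}.$$
   Context: $\langle\cdot,\cdot\rangle$ is the inner product of $\mathbb{H}$ and $\|x\|=\langle x,x\rangle^{1/2}$. *)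

(* Defs.v *)
From HB Require Import structures.
From mathcomp Require Export all_boot all_order all_algebra.
From mathcomp Require Export complex.
From mathcomp Require Export all_classical all_reals all_analysis.

Export Order.TTheory GRing.Theory Num.Theory.
Export numFieldNormedType.Exports.

Set Implicit Arguments.
Unset Strict Implicit.
Unset Printing Implicit Defensive.

Local Open Scope ring_scope.
Local Open Scope complex_scope.

(* The inner product is linear in its first argument and conjugate-linear in
   its second one. Norms of modules over R[i] have values in R[i]; the order of
   R[i] is z <= w iff w - z is a nonnegative real number. *)
HB.mixin Record CompleteNormedModule_isHilbert (R : realType) H
    of CompleteNormedModule R[i] H := {
  inner : {dot H for (@Num.conj R[i])} ;
  norm_inner : forall x : H, `|x| = sqrtC (inner x x) }.

#[short(type="hilbertType")]
HB.structure Definition Hilbert (R : realType) :=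
  { H of CompleteNormedModule_isHilbert R H & CompleteNormedModule R[i] H }.

Notation "''[' x , y ]" := (inner x%R y%R) : ring_scope.

(* Main.v *)
Require Import Defs.
From mathcomp Require Import ring.

(** Put a = <x,y> and b = <x,z>. As the form is conjugate-linear on the right,
    pairing x with the combination w = a y + b z produces exactly
    a a^* + b b^* = |a|^2 + |b|^2, so the left-hand side is |<x,w>| and
    Cauchy-Schwarz bounds it by ||x|| ||w||. Expanding ||w||^2 gives
    |a|^2 ||y||^2 + |b|^2 ||z||^2 plus a cross term and its conjugate, each of
    modulus |a| |b| |<y,z>|, whence the square root on the right-hand side.
    The second inequality is the first one with the unit vector e in the role
    of x. *)

Local Open Scope ring_scope.

Section DotForm.
Variables (C : numClosedFieldType) (U : lmodType C).
Variable form : {dot U for (@Num.conj C)}.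
Implicit Types u v x y z : U.

Lemma dot_normC u v : `|form u v| = `|form v u|.
Proof. by rewrite hermC expr0 mul1r norm_conjC. Qed.

Lemma dotZl a u v : form (a *: u) v = a * form u v.
Proof. exact: linearZl_LR. Qed.

Lemma dotZr a u v : form u (a *: v) = a^* * form u v.
Proof. exact: linearZr_LR. Qed.

(** With V = <v,v>, the vector V u - <u,v> v is V times the component of u
    orthogonal to v, and its square norm is V (<u,u> V - |<u,v>|^2); clearing
    the denominator V in this way avoids a division. *)
Lemma dot_CauchySchwarz u v : `|form u v| ^+ 2 <= form u u * form v v.
Proof.
have [->|v_neq0] := eqVneq v 0.
  by rewrite linear0r normr0 expr0n mulr_ge0 ?dnorm_ge0.
have V_gt0 : 0 < form v v by rewrite dnorm_gt0.
have := dnorm_ge0 form (form v v *: u - form u v *: v).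
rewrite dnormB !dnormZ dotZl dotZr.
rewrite (ger0_norm (ltW V_gt0)) !rmorphM /= conjCK (geC0_conj (ltW V_gt0)).
have -> : form v v ^+ 2 * form u u + `|form u v| ^+ 2 * form v v -
    (form v v * ((form u v)^* * form u v) +
     form v v * (form u v * (form u v)^*)) =
    form v v * (form u u * form v v - `|form u v| ^+ 2).
  by rewrite normCK; ring.
by rewrite pmulr_rge0 // subr_ge0.
Qed.

(** The cross terms of the expansion form the real number d + d^*, which is at
    most 2 |d|. *)
Lemma dnorm_lincomb2_le a b y z :
  form (a *: y + b *: z) (a *: y + b *: z) <=
  `|a| ^+ 2 * form y y + `|b| ^+ 2 * form z z
  + 2 * `|a| * `|b| * `|form y z|.
Proof.
rewrite dnormD !dnormZ lerD2l dotZl dotZr.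
set d := a * _.
have d_norm : `|d| = `|a| * `|b| * `|form y z|.
  by rewrite /d !normrM norm_conjC mulrA.
have d_real : d + d^* \is Num.real.
  by rewrite CrealE rmorphD /= conjCK addrC.
apply: le_trans (real_ler_norm d_real) _.
apply: le_trans (ler_normD _ _) _.
by rewrite norm_conjC d_norm -!mulrA mulr_natl mulr2n.
Qed.

(** The coefficients are chosen so that the pairing of x with the combination
    is a sum of squared moduli. *)
Lemma dot_lincomb_self x y z :
  form x (form x y *: y + form x z *: z) =
  `|form x y| ^+ 2 + `|form x z| ^+ 2.
Proof. by rewrite linearDr /= !dotZr !normCK ![_^* * _]mulrC. Qed.

Lemma dot_sum_sqr_le x y z :
  `|form x y| ^+ 2 + `|form x z| ^+ 2 <=
  sqrtC (form x x) *
  sqrtC (`|form x y| ^+ 2 * form y y + `|form x z| ^+ 2 * form z z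
         + 2 * `|form x y| * `|form x z| * `|form y z|).
Proof.
set S := (X in X <= _); set B := (X in _ * sqrtC X).
have S_ge0 : 0 <= S by rewrite addr_ge0 ?exprn_ge0.
have xx_ge0 := dnorm_ge0 form x.
have B_ge0 : 0 <= B by rewrite !addr_ge0 ?mulr_ge0 ?exprn_ge0 ?dnorm_ge0.
rewrite -sqrtCM ?nnegrE // -[S]sqrCK //.
rewrite ler_sqrtC ?nnegrE ?exprn_ge0 ?mulr_ge0 //.
rewrite -[S]ger0_norm // /S -dot_lincomb_self.
apply: le_trans (dot_CauchySchwarz _ _) _.
by rewrite ler_wpM2l ?dnorm_lincomb2_le.
Qed.

End DotForm.

Theorem lemma2p1 (R : realType) (H : hilbertType R) :
  (forall x y z : H,
     `|'[x, y]| ^+ 2 + `|'[x, z]| ^+ 2 <=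
     `|x| * sqrtC (`|'[x, y]| ^+ 2 * `|y| ^+ 2 + `|'[x, z]| ^+ 2 * `|z| ^+ 2
                   + 2 * `|'[x, y]| * `|'[x, z]| * `|'[y, z]|)) /\
  (forall x y e : H, `|e| = 1 ->
     `|'[x, e]| ^+ 2 + `|'[y, e]| ^+ 2 <=
     sqrtC (`|'[x, e]| ^+ 2 * `|x| ^+ 2 + `|'[y, e]| ^+ 2 * `|y| ^+ 2
            + 2 * `|'[x, e]| * `|'[y, e]| * `|'[x, y]|)).
Proof.
have main (x y z : H) : `|'[x, y]| ^+ 2 + `|'[x, z]| ^+ 2 <=
     `|x| * sqrtC (`|'[x, y]| ^+ 2 * `|y| ^+ 2 + `|'[x, z]| ^+ 2 * `|z| ^+ 2
                   + 2 * `|'[x, y]| * `|'[x, z]| * `|'[y, z]|).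
  by rewrite !norm_inner !sqrtCK; apply: dot_sum_sqr_le.
split=> // x y e e1; have := main e x y.
by rewrite e1 mul1r (dot_normC _ _ inner e x) (dot_normC _ _ inner e y).
Qed.
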